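(* Let $G$ be a finitely generated group. If $G$ is virtually nilpotent, then $G$ is polynomially full.
   Context: A group is virtually nilpotent if it contains a nilpotent subgroup of finite index. For a finitely generated group $G$, $G^{fin}$ is the set of finite order elements. Fixing a word length norm $\lVert\cdot\rVert$ from a finite generating set of $G$, for $h\in G$ let $C(h)$ be its conjugacy class in $G$ and $n_{h,l}:=|\{g\in C(h):\lVert g\rVert=l\}|$; $C(h)$ has polynomial growth if there are $c\in\mathbb{R}_{>0}$ and $d\in\mathbb{N}$ with $n_{h,l}\leq c\cdot l^d$ for all $l\in\mathbb{N}=\{1,2,\dots\}$; $G^{pol}:=\{g\in G : C(g)\text{ has polynomial growth}\}$. A finitely generated group $G$ is polynomially full if $G^{fin}\subseteq G^{pol}$. *)

(* Defs.v *)
From HB Require Import structures.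
From mathcomp Require Import all_boot all_order all_algebra finmap.
From mathcomp Require Import boolp classical_sets functions cardinality reals.

Set Implicit Arguments.
Unset Strict Implicit.
Unset Printing Implicit Defensive.

Import Order.TTheory GRing.Theory Num.Theory.
Local Open Scope classical_set_scope.
Local Open Scope group_scope.

Section Subgroups.
Variable G : groupType.
Implicit Types (A B H S : set G) (g x : G).

Definition is_subgroup H : Prop := group_closed (mem H).

Definition gen_subgroup S : set G := smallest is_subgroup S.

Definition generates S : Prop := gen_subgroup S = [set: G].

Definition commutator_subgroup A B : set G :=
  gen_subgroup [set [~ x, y] | x in A & y in B].

Fixpoint lower_central H (n : nat) : set G :=
  if n is m.+1 then commutator_subgroup (lower_central H m) H else H.

(* Meaningful when H is a subgroup: the lower central series is the one of H. *)
Definition nilpotent_subgroup H : Prop :=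
  exists n, lower_central H n = [set 1].

Definition finite_index H : Prop :=
  finite_set [set [set x * y | y in H] | x in [set: G]].

Definition finite_order : set G := [set g | exists2 n, (0 < n)%N & g ^+ n = 1].

Definition conj_class (h : G) : set G := [set h ^ x | x in [set: G]].

Definition word_prod S (n : nat) g : Prop :=
  exists w : seq G, [/\ size w = n,
    forall x, x \in w -> S x \/ S x^-1 & g = \prod_(x <- w) x].

(* The least length of a word for g; the default value 0 is never used when S
   generates G. *)
Definition word_norm S g : nat :=
  xget 0%N [set n | word_prod S n g /\ forall m, word_prod S m g -> (n <= m)%N].

Definition conj_sphere S (h : G) (l : nat) : set G :=
  [set g | conj_class h g /\ word_norm S g = l].

(* [fset_set] returns the empty set on infinite sets; this never happens when S
   is a finite generating set, by [finite_conj_sphere] below. *)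
Definition conj_growth S (h : G) (l : nat) : nat :=
  #|` fset_set (conj_sphere S h l)|%fset.

End Subgroups.

Definition finitely_generated (G : groupType) : Prop :=
  exists2 S : set G, finite_set S & generates S.

Definition virtually_nilpotent (G : groupType) : Prop :=
  exists H : set G, [/\ is_subgroup H, nilpotent_subgroup H & finite_index H].

Definition poly_growth (R : realType) (G : groupType) (S : set G) (h : G) : Prop :=
  exists (c : R) (d : nat), [/\ (0 < c)%R, (0 < d)%N &
    forall l, (0 < l)%N -> ((conj_growth S h l)%:R <= c * l%:R ^+ d)%R].

Definition poly_part (R : realType) (G : groupType) (S : set G) : set G :=
  [set g | poly_growth R S g].

(* The inclusion does not depend on the finite generating set S chosen to
   define the word norm, so it is required for all of them. *)
Definition polynomially_full (R : realType) (G : groupType) : Prop :=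
  forall S : set G, finite_set S -> generates S ->
    finite_order (G := G) `<=` poly_part R S.

Section Sanity.
Variable G : groupType.
Implicit Types (S : set G) (g h : G).

Lemma is_subgroupP (H : set G) : is_subgroup H <->
  [/\ H 1, forall x y, H x -> H y -> H (x * y) & forall x, H x -> H x^-1].
Proof.
split=> [HH|[H1 HM HV]].
  have HV := group_closedV HH; have HM := group_closedM HH; case: HH => H1 _.
  split; first exact/set_mem.
    by move=> x y Hx Hy; apply/set_mem/HM; exact: mem_set.
  by move=> x Hx; apply/set_mem/HV; exact: mem_set.
split; first by apply/mem_set.
by move=> x y /set_mem Hx /set_mem Hy; apply/mem_set/HM => //; exact: HV.
Qed.

Lemma gen_subgroup_group S : is_subgroup (gen_subgroup S).
Proof.
apply/is_subgroupP; split.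
- by move=> A [/is_subgroupP[]].
- move=> x y Hx Hy A [Agr AS]; have [_ HM _] := (is_subgroupP A).1 Agr.
  by apply: HM; [exact: Hx|exact: Hy].
- move=> x Hx A [Agr AS]; have [_ _ HV] := (is_subgroupP A).1 Agr.
  by apply: HV; exact: Hx.
Qed.

Lemma word_prod_gen S g : gen_subgroup S g -> exists n, word_prod S n g.
Proof.
move=> /(_ [set x | exists n, word_prod S n x]); apply; split.
  apply/is_subgroupP; split.
  - by exists 0%N, [::]; split; rewrite ?big_nil.
  - move=> x y [n [w [_ Sw ->]]] [m [v [_ Sv ->]]].
    exists (size (w ++ v)), (w ++ v); split; rewrite ?big_cat //.
    by move=> z; rewrite mem_cat => /orP[/Sw|/Sv].
  - move=> x [n [w [_ Sw ->]]].
    exists (size (rev [seq y^-1 | y <- w])), (rev [seq y^-1 | y <- w]); split=> //.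
      move=> z; rewrite mem_rev => /mapP[y /Sw Sy ->]; rewrite invgK.
      by case: Sy; [right|left].
    by rewrite -map_rev big_map prodgV revK.
move=> x Sx; exists 1%N, [:: x]; split; rewrite ?big_seq1 //.
by move=> y; rewrite inE => /eqP ->; left.
Qed.

Lemma word_normP S g : generates S ->
  word_prod S (word_norm S g) g /\
  forall m, word_prod S m g -> (word_norm S g <= m)%N.
Proof.
move=> genS; have [n wn] : exists n, word_prod S n g.
  by apply: word_prod_gen; rewrite genS.
have ex : exists n, `[< word_prod S n g >] by exists n; apply/asboolP.
case: (ex_minnP ex) => m /asboolP wm minm.
have Pm : [set n | word_prod S n g /\
    forall m, word_prod S m g -> (n <= m)%N] m.
  by split=> // k wk; apply/minm/asboolP.
by have := xgetPex 0%N (ex_intro _ m Pm).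
Qed.

Lemma finite_word_prod S n : finite_set S -> finite_set [set g | word_prod S n g].
Proof.
move=> finS; elim: n => [|n IH].
  apply: (sub_finite_set (B := [set 1])); last exact: finite_set1.
  by move=> g [w [/size0nil -> _ ->]]; rewrite big_nil.
pose T := S `|` [set x^-1 | x in S].
apply: (sub_finite_set (B := [set x * y | x in T & y in word_prod S n])).
  move=> g [[|x w] [//= [sw] Sw ->]]; rewrite big_cons; exists x.
    have [|Sx] := Sw x (mem_head _ _); first by left.
    by right; exists x^-1 => //; rewrite invgK.
  exists (\prod_(y <- w) y) => //; exists w; split=> // y yw.
  by apply: Sw; rewrite inE yw orbT.
by apply: finite_image2 => //; rewrite finite_setU; split => //; exact: finite_image.
Qed.

Lemma finite_conj_sphere S h l : finite_set S -> generates S ->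
  finite_set (conj_sphere S h l).
Proof.
move=> finS genS; apply: sub_finite_set (finite_word_prod l finS).
by move=> g [_ <-]; exact: (word_normP g genS).1.
Qed.

End Sanity.

(* Main.v *)
Require Import Defs.
From mathcomp Require Import all_boot reals.
From mathcomp Require Import all_order all_algebra finmap.
From mathcomp Require Import boolp classical_sets cardinality.

(** In a finitely generated virtually nilpotent group the whole sphere of radius
    [l] has polynomially many elements, hence so does its trace on any conjugacy
    class; this is the easy half of Wolf's theorem on growth.

    For the nilpotent subgroup [H], the growth bound comes from Lazard
    elimination ([eliminate_word]).  Given a word in letters [y :: L], collect
    all the occurrences of [y] on the left: the word becomes [y ^+ m] times a
    product of conjugates [x ^ (y ^+ k)] with [x] in [L].  By nilpotency the
    iterated commutators [[x, y], y], ... of [x] with [y] become trivial after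
    [c] steps, and [x ^ (y ^+ k)] is a product of at most [k.+1 ^ c] of the
    non-trivial ones ([word_in_conjX]).  So the length of the rest of the word
    stays polynomial, and [y] contributes only the factor given by the choices
    of [m].  The new letters lie deeper in the lower central series than the
    letters they come from, so that eliminating letters one by one, those of the
    shallowest term first, ends with the trivial alphabet
    ([nilpotent_poly_cover]).

    To pass from [H] to the whole group, Schreier's rewriting
    ([finite_index_poly_cover]) turns a word of length [n] in the generators
    into a word of length [n] in a finite subset of [H], up to multiplication by
    coset representatives on both sides. *)

Set Implicit Arguments.
Unset Strict Implicit.
Unset Printing Implicit Defensive.

Import Order.TTheory GRing.Theory Num.Theory.
Local Open Scope classical_set_scope.
Local Open Scope group_scope.

Lemma leq_expl d m n : (m <= n)%N -> (m ^ d <= n ^ d)%N.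
Proof. by case: d => // d; rewrite leq_exp2r. Qed.

Section Words.
Variable G : groupType.
Implicit Types (L : seq G) (g x y : G) (n m c : nat).

Definition word_in L n g : Prop :=
  exists w : seq G,
    [/\ (size w <= n)%N, {subset w <= L} & g = \prod_(x <- w) x].

(** Polynomial growth of the sets [E n], phrased with covering lists rather than
    cardinals so that no finiteness proof has to be carried along. *)
Definition poly_cover (E : nat -> set G) : Prop :=
  exists a d, forall n, exists2 s : seq G,
    (size s <= a * n.+1 ^ d)%N & forall g, E n g -> g \in s.

Lemma poly_cover_sub (E F : nat -> set G) :
  (forall n, E n `<=` F n) -> poly_cover F -> poly_cover E.
Proof.
move=> EF [a [d aP]]; exists a, d => n; have [s sn sF] := aP n.
by exists s => // g /EF/sF.
Qed.

Lemma word_in1 L n : word_in L n 1.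
Proof. by exists [::]; split; rewrite ?big_nil. Qed.

Lemma word_in_mem L x : x \in L -> word_in L 1 x.
Proof.
by move=> xL; exists [:: x]; split; rewrite ?big_seq1 // => z; rewrite inE => /eqP->.
Qed.

Lemma word_inM L n m g h :
  word_in L n g -> word_in L m h -> word_in L (n + m) (g * h).
Proof.
move=> [w [wn wL ->]] [v [vm vL ->]]; exists (w ++ v); split.
- by rewrite size_cat leq_add.
- by move=> z; rewrite mem_cat => /orP[/wL|/vL].
- by rewrite big_cat.
Qed.

Lemma word_in_sub L L' n m g : {subset L <= L'} -> (n <= m)%N ->
  word_in L n g -> word_in L' m g.
Proof.
move=> LL' nm [w [wn wL ->]]; exists w; split=> //.
  exact: leq_trans nm.
by move=> z /wL/LL'.
Qed.

Definition comm_iter y x n : G := iter n (fun z => [~ z, y]) x.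

(** Lazard's alphabet: the letters needed to rewrite words in [y :: L] once [y]
    has been moved out.  The letters of [L] themselves are the case [j = 0]. *)
Definition eliminate y c L : seq G :=
  [seq comm_iter y x j | x <- L, j <- iota 0 c].

(** Conjugating by [y] maps [x] to [x * [~ x, y]], hence
    [x ^ (y ^+ m.+1) = x ^ (y ^+ m) * [~ x, y] ^ (y ^+ m)], where [[~ x, y]] needs
    one commutator less than [x] to become trivial.  The lengths thus obey
    Pascal's rule, and [m.+1 ^ c] satisfies the matching inequality
    [m.+1 ^ c.+1 + m.+1 ^ c <= m.+2 ^ c.+1]. *)
Lemma word_in_conjX y m c x : comm_iter y x c = 1 ->
  word_in (eliminate y c [:: x]) (m.+1 ^ c) (x ^ (y ^+ m)).
Proof.
elim: m c x => [|m IHm] c x; case: c => [|c] xc1.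
- by rewrite [x]xc1 conj1g; exact: word_in1.
- rewrite expg0 conjg1 exp1n; apply: word_in_mem.
  by apply/allpairsPdep; exists x, 0%N; rewrite !inE.
- by rewrite [x]xc1 conj1g; exact: word_in1.
have -> : x ^ (y ^+ m.+1) = x ^ (y ^+ m) * [~ x, y] ^ (y ^+ m).
  by rewrite -conjMg commgEl mulgA mulgV mul1g expgS conjgM.
have xyc1 : comm_iter y [~ x, y] c = 1 by rewrite /comm_iter -iterSr.
have sub1 : {subset eliminate y c [:: [~ x, y]] <= eliminate y c.+1 [:: x]}.
  move=> z /allpairsPdep[_ [j [/[1!inE]/eqP-> + ->]]].
  rewrite mem_iota => /andP[_ jc]; apply/allpairsPdep; exists x, j.+1.
  by rewrite inE eqxx mem_iota /comm_iter iterSr; split.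
apply: word_in_sub (fun z zL => zL) _
  (word_inM (IHm c.+1 x xc1) (word_in_sub sub1 (leqnn _) (IHm c _ xyc1))).
rewrite [leqRHS]expnS [(m.+1 ^ c.+1)%N]expnS addnC -mulSn.
by rewrite leq_mul2l /= leq_expl.
Qed.

(** Reading the word from its right end, a letter [x] of [L] passes through the
    power of [y] already collected by [x * y ^+ m = y ^+ m * x ^ (y ^+ m)]. *)
Lemma eliminate_word y c L n g :
  {in L, forall x, comm_iter y x c = 1} -> word_in (y :: L) n g ->
  exists m v, [/\ (m <= n)%N, word_in (eliminate y c L) (n * n.+1 ^ c) v
    & g = y ^+ m * v].
Proof.
move=> L1 [w [wn wL ->]] {g}.
elim: w n wn wL => [|x w IHw] [|n] // wn wL.
- by exists 0%N, 1; split; rewrite ?big_nil ?mulg1 //; exact: word_in1.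
- by exists 0%N, 1; split; rewrite ?big_nil ?mulg1 //; exact: word_in1.
have [//||m [v [mn vL wE]]] := IHw n.
  by move=> z zw; apply: wL; rewrite inE zw orbT.
rewrite big_cons wE.
have := wL x (mem_head _ _); rewrite inE => /predU1P[->|xL].
  exists m.+1, v; split; rewrite ?expgS ?mulgA //.
  by apply: word_in_sub vL => //; rewrite leq_mul // leq_expl.
exists m, (x ^ (y ^+ m) * v); split; first exact: leqW.
  rewrite mulSn; apply: word_inM.
    have sub1 : {subset eliminate y c [:: x] <= eliminate y c L}.
      move=> z /allpairsPdep[_ [j [/[1!inE]/eqP-> jc ->]]].
      by apply/allpairsPdep; exists x, j.
    apply: word_in_sub sub1 _ (word_in_conjX m (L1 x xL)).
    by rewrite leq_expl // ltnS leqW.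
  by apply: word_in_sub vL => //; rewrite leq_mul // leq_expl.
by rewrite mulgA (conjgC x) -mulgA.
Qed.

(** The words of length [n] are covered by the products [y ^+ m * v] with
    [m <= n] and [v] of length at most [n * n.+1 ^ c], and substituting a
    polynomial into a polynomial bound gives a polynomial bound. *)
Lemma poly_cover_eliminate y c L :
  {in L, forall x, comm_iter y x c = 1} ->
  poly_cover (word_in (eliminate y c L)) -> poly_cover (word_in (y :: L)).
Proof.
move=> L1 [a [d aP]]; exists a, (c.+1 * d).+1 => n.
have [s sn sE] := aP (n * n.+1 ^ c)%N.
exists [seq y ^+ m * v | m <- iota 0 n.+1, v <- s].
  rewrite size_allpairs size_iota expnS mulnCA leq_mul2l /=.
  apply: leq_trans sn _; rewrite leq_mul2l expnM; apply/orP; right.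
  have le1 : ((n * n.+1 ^ c).+1 <= n.+1 ^ c.+1)%N.
    by rewrite expnS mulSn -add1n leq_add2r expn_gt0.
  exact: leq_expl.
move=> g /(eliminate_word L1)[m [v [mn /sE vs ->]]].
by apply/allpairsPdep; exists m, v; split; rewrite // mem_iota.
Qed.

End Words.

Section Nilpotent.
Variables (G : groupType) (H : set G).
Hypothesis H_subgroup : is_subgroup H.

Lemma comm_lower_central i x y :
  lower_central H i x -> H y -> lower_central H i.+1 [~ x, y].
Proof. by move=> Hx Hy A [_]; apply; exists x => //; exists y. Qed.

Lemma lower_centralS i : lower_central H i.+1 `<=` lower_central H i.
Proof.
elim: i => [|i IHi] g; apply; split.
- exact: H_subgroup.
- have [_ HM HV] := (is_subgroupP H).1 H_subgroup.
  move=> _ [x Hx [y Hy <-]].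
  exact: HM (HV _ Hx) (HM _ _ (HV _ Hy) (HM _ _ Hx Hy)).
- exact: gen_subgroup_group.
- by move=> _ [x Hx [y Hy <-]]; apply: comm_lower_central => //; exact: IHi.
Qed.

Lemma lower_central_sub i : lower_central H i `<=` H.
Proof. by elim: i => // i IHi; exact: subset_trans (@lower_centralS i) IHi. Qed.

Lemma comm_iter_lower_central y i x n : H y ->
  lower_central H i x -> lower_central H (i + n) (comm_iter y x n).
Proof.
move=> Hy Hx; elim: n => [|n IHn]; first by rewrite addn0.
by rewrite addnS; exact: comm_lower_central.
Qed.

Lemma lower_central_le i n : lower_central H (i + n) `<=` lower_central H i.
Proof.
elim: n => [|n IHn]; first by rewrite addn0.
by rewrite addnS; exact: subset_trans (@lower_centralS _) IHn.
Qed.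

(** Double induction: on the depth [i] in the lower central series, downwards from
    the trivial term, and, for letters of depth [i], on the number of those not
    known to have depth [i.+1].  Eliminating one of them creates only letters of
    depth [i.+1]. *)
Lemma nilpotent_poly_cover (L : seq G) : nilpotent_subgroup H ->
  {in L, forall x, H x} -> poly_cover (word_in L).
Proof.
move=> [c Hc1] LH.
have iter1 x y : H x -> H y -> comm_iter y x c = 1.
  by move=> Hx Hy; have := comm_iter_lower_central (i := 0) c Hy Hx; rewrite add0n Hc1.
suff main j i : (i + j)%N = c -> forall K, {in K, forall x, lower_central H i x} ->
    poly_cover (word_in K) by exact: (main c 0%N).
(* [j] is the number of terms of the series left before it becomes trivial. *)
elim: j i => [|j IHj] i ijc K Ki.
  exists 1%N, 0%N => n; exists [:: 1] => // g [w [_ wK ->]].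
  rewrite inE big1_seq // => x /= /wK/Ki; rewrite -[i]addn0 ijc Hc1; exact.
suff inner A B : {in A, forall x, lower_central H i x} ->
    {in B, forall x, lower_central H i.+1 x} -> poly_cover (word_in (A ++ B)).
  by rewrite -[K]cats0; exact: inner.
elim: A B => [|y A IHA] B Ai Bi; first by apply: IHj Bi; rewrite -ijc addnS.
have {}ABi x : x \in A ++ B -> lower_central H i x.
  rewrite mem_cat => /orP[xA|/Bi/lower_centralS//].
  by apply: Ai; rewrite inE xA orbT.
have Hy : H y by apply/(@lower_central_sub i)/Ai/mem_head.
rewrite cat_cons; apply: (poly_cover_eliminate (c := c)).
  by move=> x /ABi/lower_central_sub Hx; exact: iter1.
have Ai' : {in A, forall x, lower_central H i x}.
  by move=> x xA; apply: ABi; rewrite mem_cat xA.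
(* The letters created by the elimination of [y]: being commutators, they can
   join [B], and [A] has lost the letter [y]. *)
pose B' := B ++ [seq comm_iter y x j.+1 | x <- A ++ B, j <- iota 0 c].
have B'i : {in B', forall x, lower_central H i.+1 x}.
  move=> z; rewrite mem_cat => /orP[/Bi//|/allpairsPdep[x [k [/ABi xi _ ->]]]].
  have := comm_iter_lower_central k.+1 Hy xi.
  by rewrite addnS -addSn; exact: lower_central_le.
apply: poly_cover_sub (IHA B' Ai' B'i) => n g; apply: word_in_sub => //.
move=> z /allpairsPdep[x [[|k] [xAB kc ->]]].
  by rewrite /B' catA mem_cat xAB.
rewrite /B' catA mem_cat; apply/orP; right; apply/allpairsPdep.
by exists x, k; split=> //; move: kc; rewrite !mem_iota => /andP[_ /ltnW].
Qed.

Lemma finite_index_transversal : finite_index H ->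
  exists T : seq G, forall g, exists2 t, t \in T & H (t^-1 * g).
Proof.
have [H1 HM HV] := (is_subgroupP H).1 H_subgroup.
move=> /finite_seqP[Cs CsE].
pose rep (C : set G) := xget 1 C.
exists (map rep Cs) => g.
have : [set` Cs] [set g * y | y in H] by rewrite -CsE; exists g.
move=> /= gCs; exists (rep [set g * y | y in H]); first exact: map_f.
have : [set g * y | y in H] (rep [set g * y | y in H]).
  by apply: xgetPex; exists g, 1; rewrite ?mulg1.
by case=> y Hy <-; rewrite invgM -mulgA mulVg mulg1; exact: HV.
Qed.

(** Schreier rewriting.  With [T] a list of representatives of the left cosets of
    [H], each letter [s] and each [t] in [T] satisfy [s * t = t' * z] with [t'] in
    [T] and [z] in [H].  Pushing a representative through a word from right to
    left replaces each letter by such a [z], and these form a finite subset [Y]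
    of [H]. *)
Lemma finite_index_poly_cover (S : set G) : finite_set S -> finite_index H ->
  (forall L : seq G, {in L, forall x, H x} -> poly_cover (word_in L)) ->
  poly_cover (word_prod S).
Proof.
move=> /finite_seqP[S0 ->] /finite_index_transversal[T TP] growthH.
pose Y := [seq z <- [seq t'^-1 * u.1 * u.2 | t' <- T,
  u <- [seq (s, t) | s <- S0 ++ [seq s^-1 | s <- S0], t <- T]] | `[< H z >]].
have [|a [d aP]] := growthH Y.
  by move=> z; rewrite mem_filter => /andP[/asboolP].
(* The empty word is written [t0 * 1 * t0^-1]; thus [1] need not be in [T]. *)
have [t0 t0T _] := TP 1.
exists (size T * a)%N, d => n; have [s sn sY] := aP n.
exists [seq t * v * t0^-1 | t <- T, v <- s].
  by rewrite size_allpairs -mulnA leq_mul2l sn orbT.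
move=> _ [w [wn wS ->]].
suff [t [v [tT vY ->]]] : exists t v,
    [/\ t \in T, word_in Y n v & \prod_(x <- w) x = t * v * t0^-1].
  by apply/allpairsPdep; exists t, v; split=> //; exact: sY.
elim: w n wn wS {a d aP s sn sY} => [|x w IHw] n wn wS.
  by exists t0, 1; split; rewrite ?big_nil ?mulg1 ?mulgV //; exact: word_in1.
case: n wn => // n [wn].
have [//||t [v [tT vY wE]]] := IHw n.
  by move=> z zw; apply: wS; rewrite inE zw orbT.
have [t' t'T Ht'] := TP (x * t).
exists t', (t'^-1 * x * t * v); split=> //.
  rewrite -add1n; apply: word_inM vY; apply: word_in_mem.
  rewrite mem_filter; apply/andP; split; first by apply/asboolP; rewrite -mulgA.
  apply/allpairsPdep; exists t', (x, t); split=> //.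
  apply/allpairsPdep; exists x, t; split=> //; rewrite mem_cat.
  have [/= ->//|/= xS] := wS x (mem_head _ _).
  by apply/orP; right; apply/mapP; exists x^-1; rewrite ?invgK.
by rewrite big_cons wE !mulgA mulgV mul1g.
Qed.

End Nilpotent.

Lemma conj_growth_le (G : groupType) (S : set G) h l (s : seq G) :
  finite_set S -> generates S ->
  (forall g, word_prod S l g -> g \in s) -> (conj_growth S h l <= size s)%N.
Proof.
move=> finS genS sP.
have fin := finite_conj_sphere h l finS genS.
apply: (@leq_trans #|` [fset x in s]%fset|).
  apply/fsubset_leq_card/fsubsetP => g.
  rewrite in_fset_set // inE => -[_ gl]; rewrite !inE; apply: sP.
  by rewrite -gl; exact: (word_normP g genS).1.
by rewrite card_fseq size_undup.
Qed.

Theorem corollary5p8 (R : realType) (G : groupType)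
  (G_fg : finitely_generated G) (G_vn : virtually_nilpotent G) :
  polynomially_full R G.
Proof.
have [H [H_subgroup H_nil H_fin]] := G_vn.
move=> S finS genS h _.
have [a [d aP]] : poly_cover (word_prod S).
  apply: (finite_index_poly_cover H_subgroup) => // L.
  exact: nilpotent_poly_cover.
(* The bound is a polynomial in [l.+1], and [l.+1 <= 2 * l] as [l] is positive;
   the successors make the constant and the degree positive. *)
exists (a * 2 ^ d.+1).+1%:R%R, d.+1; split=> // l l_gt0.
have [s sl sP] := aP l.
rewrite -natrX -natrM ler_nat.
apply: leq_trans (conj_growth_le h finS genS sP) _.
apply: leq_trans sl _.
apply: (@leq_trans (a * 2 ^ d.+1 * l ^ d.+1)); last by rewrite leq_mul2r leqnSn orbT.
rewrite -mulnA -expnMn leq_mul2l; apply/orP; right.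
apply: (@leq_trans (l.+1 ^ d.+1)); first by rewrite leq_exp2l.
by rewrite leq_expl // mul2n -addnn -add1n leq_add2r.
Qed.
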